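(* Let $n \in \mathbb{N}$ with $n \geq 3$ and let $\{D_{i,j}\}_{i,j \in \{1,\dots,n\}}$ be a family of positive real numbers. There exists a positive-weighted tree $\mathcal{T}=(T,w)$ with exactly $n$ vertices, namely $V(T)=\{1,\dots,n\}$, such that $D_{i,j}(\mathcal{T})=D_{i,j}$ for all $i,j \in \{1,\dots,n\}$ if and only if the following three conditions hold: \begin{itemize} \item[(four-point condition)] for all $i,j,k,h \in \{1,\dots,n\}$, the maximum of $\{D_{i,j}+D_{k,h},\ D_{i,k}+D_{j,h},\ D_{i,h}+D_{k,j}\}$ is attained at least twice; \item[(i)] if for some $i,j,k,t \in \{1,\dots,n\}$ we have $D_{i,j}+D_{k,t}=D_{i,k}+D_{j,t}=D_{i,t}+D_{j,k}$, then there is an element $l \in \{1,\dots,n\}$ such that $D_{u,v}=D_{u,l}+D_{v,l}$ for all distinct $u,v \in \{i,j,k,t\}$; \item[(ii)] if for some $i,j,k,t \in \{1,\dots,n\}$ we have $D_{i,j}+D_{k,t}<D_{i,k}+D_{j,t}=D_{i,t}+D_{j,k}$, then for any choice of three elements $u,v,w \in \{i,j,k,t\}$ there exists an element $l \in \{1,\dots,n\}$ such that $D_{u,v}=D_{u,l}+D_{v,l}$, $D_{u,w}=D_{u,l}+D_{w,l}$, $D_{v,w}=D_{v,l}+D_{w,l}$, and $D_{u,v}+D_{w,l}=D_{u,w}+D_{v,l}=D_{u,l}+D_{v,w}$. \end{itemize} Moreover, if such a tree $\mathcal{T}$ exists, then it is unique.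
   Context: A weighted tree $\mathcal{T}=(T,w)$ is a (finite) tree $T$ with a function $w:E(T)\to\mathbb{R}$; it is positive-weighted if $w(e)>0$ for every edge $e$. For distinct vertices $i,j$ of $T$, $D_{i,j}(\mathcal{T})$ denotes the sum of the weights of the edges of the unique path in $T$ joining $i$ and $j$, and $D_{i,i}(\mathcal{T})=0$. The family $\{D_{i,j}\}$ is symmetric ($D_{i,j}=D_{j,i}$, indexed by unordered pairs) with $D_{i,i}=0$ and $D_{i,j}>0$ for $i\neq j$. *)

(* Defs.v *)
From HB Require Import structures.
From mathcomp Require Import all_boot all_order all_algebra.
From mathcomp Require Import reals.

Set Implicit Arguments.
Unset Strict Implicit.
Unset Printing Implicit Defensive.

Import Order.TTheory GRing.Theory Num.Theory.
Local Open Scope ring_scope.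

(* A simple graph on the vertex set V is given by its set of edges, each edge
   being a two-element subset of V. *)
Definition adj (V : finType) (E : {set {set V}}) : rel V :=
  fun x y => [set x; y] \in E.

Definition is_tree (V : finType) (E : {set {set V}}) : Prop :=
  [/\ (0 < #|V|)%N,
      forall e, e \in E -> #|e| = 2%N,
      forall x y, connect (adj E) x y
    & forall c : seq V, (2 < size c)%N -> ~ ucycle (adj E) c].

(* The weights form a finite function whose domain is exactly the edge set, so
   that Leibniz equality of weighted trees means: same edges, same weights. *)
Record weighted_tree (R : realType) (V : finType) := WeightedTree {
  edges : {set {set V}};
  edgesP : is_tree edges;
  weight : {ffun {e : {set V} | e \in edges} -> R}
}.

Definition positive_weighted (R : realType) (V : finType)
    (T : weighted_tree R V) : Prop :=
  forall e, 0 < weight T e.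

Definition simple_path (V : finType) (E : {set {set V}}) (x y : V)
    (p : seq V) : bool :=
  [&& path (adj E) x p, uniq (x :: p) & last x p == y].

Lemma tree_path_subproof (R : realType) (V : finType) (T : weighted_tree R V)
  (x y : V) : exists p, simple_path (edges T) x y p.
Proof.
have [_ _ conT _] := edgesP T.
have /connectP[p pth ->] := conT x y.
have [p' pth' uniq_p' _] := shortenP pth.
by exists p'; rewrite /simple_path pth' uniq_p' eqxx.
Qed.

(* The vertices after x on the path of T from x to y; as T is a tree, the
   simple path selected by xchoose is the only one. *)
Definition tree_path (R : realType) (V : finType) (T : weighted_tree R V)
    (x y : V) : seq V :=
  xchoose (tree_path_subproof T x y).

Definition path_edges (V : finType) (x : V) (p : seq V) : seq {set V} :=
  pairmap (fun a b => [set a; b]) x p.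

Definition tree_dist (R : realType) (V : finType) (T : weighted_tree R V)
    (x y : V) : R :=
  \sum_(e : {e : {set V} | e \in edges T}
          | val e \in path_edges x (tree_path T x y)) weight T e.

Definition realizes (R : realType) (V : finType) (T : weighted_tree R V)
    (D : V -> V -> R) : Prop :=
  positive_weighted T /\ forall i j, tree_dist T i j = D i j.

Definition max_attained_twice (R : realType) (a b c : R) : Prop :=
  let m := Num.max a (Num.max b c) in
  [\/ a = m /\ b = m, a = m /\ c = m | b = m /\ c = m].

(* Main.v *)
(** In a tree, three vertices have a median, and a vertex on the path from [x]
    to [y] lies on the path from [x] to [t] or on the path from [t] to [y]; these
    two facts give the four-point condition, (i) and (ii).

    Conversely, (ii) for the quadruple [(x, y, z, z)], with the triangle
    inequality (itself the four-point condition for that quadruple), gives a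
    median of [x], [y], [z]. Join two points when no third point lies between
    them. Two edges [xy] and [yz] with [x <> z] then satisfy
    [D x z = D x y + D y z], since their median can only be [y], and the
    four-point condition extends this additivity to every simple path. Hence
    there are no cycles, and path lengths are given by [D]. Any tree realizing
    [D] has these edges, whence uniqueness. *)

Require Import Defs.
From HB Require Import structures.
From mathcomp Require Import all_boot all_order all_algebra.
From mathcomp Require Import boolp reals.
From mathcomp Require Import lra.

Set Implicit Arguments.
Unset Strict Implicit.
Unset Printing Implicit Defensive.

Import Order.TTheory GRing.Theory Num.Theory.
Local Open Scope ring_scope.

(** * Simple paths in acyclic graphs *)

Lemma adj_sym (V : finType) (E : {set {set V}}) : symmetric (adj E).
Proof. by move=> x y; rewrite /adj setUC. Qed.

Lemma simple_path_split (V : finType) (E : {set {set V}}) (x y : V) p q :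
  simple_path E x y (p ++ q) ->
  simple_path E x (last x p) p /\ simple_path E (last x p) y q.
Proof.
rewrite /simple_path cat_path last_cat -cat_cons cat_uniq.
case/and3P=> /andP[pp pq] /and3P[up dis uq] ly; rewrite pp up eqxx pq ly /= uq.
split=> //; rewrite !andbT; apply/negP=> lq; case/hasP: dis.
by exists (last x p); rewrite // mem_last.
Qed.

Lemma simple_path_cat (V : finType) (E : {set {set V}}) (x y z : V) p q :
  simple_path E x y p -> simple_path E y z q ->
  {in q, forall v, v \notin x :: p} -> simple_path E x z (p ++ q).
Proof.
case/and3P=> pp up /eqP ly /and3P[pq /andP[_ uq] lz] dis.
rewrite /simple_path cat_path last_cat ly pp pq lz andbT -cat_cons cat_uniq up.
have {}uq : uniq q := uq.
by rewrite uq !andbT; apply/hasPn.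
Qed.

Lemma simple_path_rev (V : finType) (E : {set {set V}}) (x y : V) p :
  simple_path E x y p -> exists2 q, simple_path E y x q & y :: q =i x :: p.
Proof.
case/and3P=> pp up /eqP <-; exists (rev (belast x p)).
  rewrite /simple_path rev_path; apply/and3P; split.
  - by rewrite (eq_path (e' := adj E)) // => a b; rewrite adj_sym.
  - by rewrite -rev_rcons -lastI rev_uniq.
  - by case: (p) => //= a s; rewrite rev_cons last_rcons.
by move=> v; rewrite -rev_rcons -lastI mem_rev.
Qed.

Lemma path_edges_mem (V : finType) (x v : V) p (e : {set V}) :
  e \in path_edges x p -> v \in e -> v \in x :: p.
Proof.
elim: p x => //= a p IH x; rewrite inE => /orP[/eqP->|ein vin].
  by rewrite !inE => /orP[]/eqP->; rewrite eqxx ?orbT.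
by rewrite inE IH ?orbT.
Qed.

Lemma path_edges_uniq (V : finType) (x : V) p :
  uniq (x :: p) -> uniq (path_edges x p).
Proof.
elim: p x => //= a p IH x /andP[xa up]; rewrite (IH a up) andbT.
by apply: contra xa => /path_edges_mem; apply; rewrite !inE eqxx.
Qed.

Lemma path_edges_sub (V : finType) (E : {set {set V}}) (x : V) p :
  path (adj E) x p -> {subset path_edges x p <= E}.
Proof.
elim: p x => //= a p IH x /andP[xa pp] e; rewrite inE => /orP[/eqP->//|].
exact: IH.
Qed.

(** Serves to find medians: a prefix that meets [S] only in its endpoint can be continued inside [S]
    without repeating a vertex. *)
Lemma first_hit (V : eqType) (S : pred V) x p : has S (x :: p) ->
  exists p1 p2, [/\ p = p1 ++ p2, S (last x p1)
    & {in x :: p1, forall v, S v -> v = last x p1}].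
Proof.
elim: p x => [|a p IH] x.
  by rewrite has_seq1 => Sx; exists [::], [::]; split=> // v; rewrite inE => /eqP.
have [Sx _|nSx] := boolP (S x).
  by exists [::], (a :: p); split=> // v; rewrite inE => /eqP.
rewrite [has _ _]/= (negPf nSx) => /IH [p1 [p2 [-> Sl h]]].
exists (a :: p1), p2; split=> // v; rewrite inE => /orP[/eqP->|/h//].
by rewrite (negPf nSx).
Qed.

(* Two simple paths leaving [x] through different neighbours [a] and [b] give
   a walk from [a] to [b] avoiding [x], which closes up to a cycle. *)
Lemma simple_path_unique (V : finType) (E : {set {set V}}) (x y : V) p q :
  (forall c : seq V, (2 < size c)%N -> ~ ucycle (adj E) c) ->
  simple_path E x y p -> simple_path E x y q -> p = q.
Proof.
move=> acyc; elim: p x q => [|a p IH] x [|b q] //.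
- case/and3P=> _ _ /eqP /= <- /and3P[_ /= /andP[xq _] /eqP lx].
  by rewrite -[X in X \notin _]lx mem_last in xq.
- move=> sp /and3P[_ _ /eqP /= xy]; case/and3P: sp; rewrite -xy.
  move=> _ /= /andP[xq _] /eqP lx.
  by rewrite -[X in X \notin _]lx mem_last in xq.
move=> sp sq.
have [/andP[xa _] sp'] := simple_path_split (p := [:: a]) sp.
have [/andP[xb _] sq'] := simple_path_split (p := [:: b]) sq.
have [eab|nab] := eqVneq a b; first by rewrite -eab (IH a q) // eab.
exfalso.
have xp : x \notin a :: p by case/and3P: sp => _ /= /andP[].
have xq : x \notin b :: q by case/and3P: sq => _ /= /andP[].
have [q' sbq mq'] := simple_path_rev sq'.
case/and3P: sp' => /= pp _ /eqP lp.
case/and3P: sbq => /= pq' _ /eqP lq'.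
have pw : path (adj E) a (p ++ q') by rewrite cat_path pp lp.
have lw : last a (p ++ q') = b by rewrite last_cat lp.
case: (shortenP pw) lw => r pr ur sr lr.
have xr : x \notin a :: r.
  apply: contra xp; rewrite !inE => /orP[->//|/sr].
  rewrite mem_cat => /orP[->|xq']; first by rewrite orbT.
  by move: xq; rewrite -mq' inE xq' orbT.
(* Since [a != b], [r] is not empty and the cycle has at least three vertices. *)
apply: (acyc (x :: a :: r)); first by case: (r) lr nab => //= ->; rewrite eqxx.
rewrite /ucycle /cycle rcons_path cons_uniq xr ur /= !andbT.
by move: xa xb; rewrite /= !andbT lr => -> xb; rewrite pr adj_sym.
Qed.

(** * Medians and the four-point condition *)

Definition between (R : realType) (V : finType) (D : V -> V -> R) (x z y : V) :=
  D x y == D x z + D z y.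

Definition has_medians (R : realType) (V : finType) (D : V -> V -> R) :=
  forall x y z : V, exists m,
    [/\ between D x m y, between D x m z & between D y m z].

Definition four_point (R : realType) (V : finType) (D : V -> V -> R) :=
  forall i j k h : V,
    max_attained_twice (D i j + D k h) (D i k + D j h) (D i h + D k j).

Lemma max_attained_twiceP (R : realType) (a b c : R) :
  max_attained_twice a b c <->
  [\/ a = b /\ c <= a, a = c /\ b <= a | b = c /\ a <= b].
Proof.
rewrite /max_attained_twice /=.
by split; case: (leP b c) => bc; [case: (leP a c)|case: (leP a b)
     |case: (leP a c)|case: (leP a b)] => abc => -[] [h1 h2];
   by [apply: Or31; split; lra | apply: Or32; split; lra
      | apply: Or33; split; lra].
Qed.

Section Metric.
Variables (R : realType) (V : finType) (D : V -> V -> R).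
Hypothesis D_sym : forall x y, D x y = D y x.
Hypothesis D_diag : forall x, D x x = 0.
Hypothesis D_pos : forall x y, x != y -> 0 < D x y.

Let D_ge0 x y : 0 <= D x y.
Proof. by have [->|/D_pos/ltW//] := eqVneq x y; rewrite D_diag. Qed.

Lemma four_point_triangle : four_point D ->
  forall x y z, D x y <= D x z + D z y.
Proof.
move=> fp x y z; have := fp x y z z; rewrite (D_sym y z) D_diag.
by case/max_attained_twiceP=> -[*]; lra.
Qed.

(** With [m] a median of the three points, the right-hand side exceeds the left by [2 * D m z]. *)
Lemma medians_triangle : has_medians D ->
  forall x y z, D x y <= D x z + D z y.
Proof.
move=> med x y z; have [m [/eqP h1 /eqP h2 /eqP h3]] := med x y z.
by have := D_ge0 m z; rewrite (D_sym z y) h1 h2 h3 (D_sym m y); lra.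
Qed.

(** Let [m] be a median of [a], [b], [c]. In each pair of these, [m] is between [t] and one member,
    so this holds for at least two of the three points. The two sums pairing these points with [t]
    are equal, and the triangle inequality through [m] bounds the third. *)
Lemma cut_medians_four_point :
  has_medians D ->
  (forall x y p t, between D x p y -> between D x p t \/ between D t p y) ->
  four_point D.
Proof.
move=> med cut a b c t; apply/max_attained_twiceP.
have tri := medians_triangle med.
have [m [ab ac bc]] := med a b c.
have [cab cac cbc] := And3 (cut _ _ _ t ab) (cut _ _ _ t ac) (cut _ _ _ t bc).
move: ab ac bc cab cac cbc (tri a t m) (tri b t m) (tri c t m).
rewrite /between (D_sym m b) (D_sym m c) (D_sym t m) (D_sym t b) (D_sym t c).
rewrite (D_sym c b) => /eqP -> /eqP -> /eqP ->.
case=> /eqP h1 [] /eqP h2 [] /eqP h3 t1 t2 t3;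
  by [apply: Or31; split; lra | apply: Or32; split; lra
      | apply: Or33; split; lra].
Qed.

(** * The tree of a median metric *)

Definition gap (x y : V) : bool :=
  (x != y) && [forall z, between D x z y ==> (z == x) || (z == y)].

Definition gap_edges : {set {set V}} :=
  [set e | [exists x, exists y, (e == [set x; y]) && gap x y]].

(* On a two-element set [{x, y}] the double sum counts [D x y] twice. *)
Definition edge_length (e : {set V}) : R :=
  (\sum_(x in e) \sum_(y in e) D x y) / 2.

Lemma edge_length2 x y : x != y -> edge_length [set x; y] = D x y.
Proof.
move=> nxy; have nx : x \notin [set y] by rewrite inE.
rewrite /edge_length big_setU1 //= big_set1 !big_setU1 //= !big_set1 !D_diag.
by rewrite (D_sym y x); lra.
Qed.

Lemma gap_sym x y : gap x y = gap y x.
Proof.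
rewrite /gap eq_sym; congr (_ && _); apply: eq_forallb => z.
by rewrite /between D_sym addrC (D_sym z) (D_sym x) orbC.
Qed.

Lemma adj_gap x y : adj gap_edges x y = gap x y.
Proof.
apply/idP/idP => [|g]; rewrite /adj inE; last first.
  by apply/existsP; exists x; apply/existsP; exists y; rewrite eqxx.
case/existsP=> a /existsP[b /andP[/eqP e g]].
have nab : a != b by case/andP: g.
have := set21 x y; have := set22 x y; rewrite e !inE.
have := set21 a b; have := set22 a b; rewrite -e !inE.
move=> h1 h2 /orP[]/eqP yE /orP[]/eqP xE; subst x y => //; last first.
- by rewrite orbb eq_sym in h2; rewrite (eqP h2) eqxx in nab.
- by rewrite gap_sym.
- by rewrite orbb in h1; rewrite (eqP h1) eqxx in nab.
Qed.

Lemma gapP x y z : gap x y -> between D x z y -> z = x \/ z = y.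
Proof.
by case/andP=> _ /forallP/(_ z)/implyP h /h /orP[]/eqP; [left|right].
Qed.

Section FromMetric.
Hypothesis fourD : four_point D.
Hypothesis medD : has_medians D.

Let tri := four_point_triangle fourD.

(** Induction on the number of points between [x] and [y]: a third point [z] between them splits the
    interval into two smaller ones, the first without [y], the second without [x]. *)
Lemma gap_connect x y : connect (adj gap_edges) x y.
Proof.
have [n] := ubnP #|[set z | between D x z y]|.
elim: n x y => // n IH x y; rewrite ltnS => le_n.
have [->|nxy] := eqVneq x y; first exact: connect0.
have [g|] := boolP (gap x y); first by apply: connect1; rewrite adj_gap.
rewrite /gap nxy negb_forall => /existsP[z]; rewrite negb_imply negb_or.
case/and3P=> /eqP bz /D_pos nzx /D_pos nzy.
move: nzx; rewrite D_sym => nzx.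
apply: (@connect_trans _ _ z); apply: IH; apply: leq_trans le_n;
  apply: proper_card; apply/properP; split.
- apply/subsetP=> v; rewrite !inE /between => /eqP h.
  by rewrite eq_le tri /=; have := tri v y z; lra.
- exists y; rewrite !inE /between ?D_diag ?addr0 //.
  by apply/eqP=> h; have := D_sym y z; lra.
- apply/subsetP=> v; rewrite !inE /between => /eqP h.
  by rewrite eq_le tri /=; have := tri x v z; lra.
- exists x; rewrite !inE /between ?D_diag ?add0r //.
  by apply/eqP=> h; have := D_sym x z; lra.
Qed.

Lemma gap_gap_between x y z : gap x y -> gap y z -> x != z -> between D x y z.
Proof.
move=> gxy gyz nxz; have [m [bxy bxz byz]] := medD x y z.
have [mx|<-//] := gapP gxy bxy.
have [<-//|mz] := gapP gyz byz.
by rewrite -mx -mz eqxx in nxz.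
Qed.

(* The four-point condition propagates betweenness along the path. *)
Lemma gap_path_between x a p :
  path (adj gap_edges) x (a :: p) -> uniq (x :: a :: p) ->
  between D x a (last a p).
Proof.
elim: p x a => [|b p IH] x a; first by rewrite /between /= D_diag addr0.
move=> pth unq.
have /and3P[xa ab _] : [&& adj gap_edges x a, adj gap_edges a b
  & path (adj gap_edges) b p] by [].
have /eqP h : between D a b (last b p).
  by apply: IH; [case/andP: pth | case/andP: unq].
rewrite !adj_gap in xa ab.
have nxb : x != b by move: unq; rewrite /= !inE !negb_or => /andP[/and3P[]].
have /eqP hx := gap_gap_between xa ab nxb.
have ab_gt0 : 0 < D a b by apply: D_pos; case/andP: ab.
rewrite /= /between; apply/eqP.
(* The first sum is [2 * D a b] below the second, so the second and third agree; cancelling [D a b]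
   gives the claim. *)
have := fourD x a b (last b p); rewrite (D_sym b a) => /max_attained_twiceP.
by case=> -[*]; lra.
Qed.

Lemma gap_path_length x p :
  path (adj gap_edges) x p -> uniq (x :: p) ->
  \sum_(e <- path_edges x p) edge_length e = D x (last x p).
Proof.
elim: p x => [|a p IH] x pth unq; first by rewrite /= big_nil D_diag.
rewrite /= big_cons IH; [|by case/andP: pth|by case/andP: unq].
rewrite edge_length2 ?(eqP (gap_path_between pth unq)) //.
by case/andP: unq; rewrite inE negb_or => /andP[].
Qed.

Lemma gap_tree : (0 < #|V|)%N -> is_tree gap_edges.
Proof.
move=> V_gt0; split=> //.
- move=> e; rewrite inE => /existsP[x /existsP[y /andP[/eqP -> /andP[nxy _]]]].
  by rewrite cards2 nxy.
- exact: gap_connect.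
(* A cycle is a simple path whose ends are joined by an edge. The path puts its second vertex [a]
   between the ends, but nothing lies strictly inside a gap. *)
case=> [|x [|a [|b c]]] // _ /andP[cyc unq].
have pth : path (adj gap_edges) x [:: a, b & c].
  by move: cyc; rewrite /cycle rcons_path => /andP[].
have lx : gap x (last b c).
  by move: cyc; rewrite /cycle rcons_path gap_sym adj_gap => /andP[_].
case: (gapP lx (gap_path_between pth unq)) => ea.
  by move: unq; rewrite ea /= inE eqxx.
by move: unq => /=; rewrite {2}ea mem_last /= andbF.
Qed.

End FromMetric.
End Metric.

(** * The distance of a weighted tree *)

Section Tree.
Variables (R : realType) (V : finType) (T : weighted_tree R V).

(** The extension by 0 to all vertex sets lets sums run over the plain sequence [path_edges], with
    no membership proofs. *)
Definition edge_weight (e : {set V}) : R :=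
  if insub e is Some e' then weight T e' else 0.

Lemma edge_weightE (e : {e : {set V} | e \in edges T}) :
  edge_weight (val e) = weight T e.
Proof. by rewrite /edge_weight valK. Qed.

Lemma tree_pathP x y : simple_path (edges T) x y (tree_path T x y).
Proof. exact: xchooseP. Qed.

Lemma tree_pathE x y p : simple_path (edges T) x y p -> tree_path T x y = p.
Proof.
by case: (edgesP T) => _ _ _ acyc; apply: simple_path_unique acyc (tree_pathP x y).
Qed.

Lemma tree_distE x y p : simple_path (edges T) x y p ->
  tree_dist T x y = \sum_(e <- path_edges x p) edge_weight e.
Proof.
move=> sp; rewrite /tree_dist (tree_pathE sp); case/and3P: sp => pp up _.
rewrite big_uniq ?path_edges_uniq //=.
under eq_bigr do rewrite -edge_weightE.
rewrite -(big_sub_cond (mem (edges T)) (mem (path_edges x p))).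
apply: eq_bigl => e; apply: andb_idl; exact: path_edges_sub.
Qed.

Lemma tree_dist_cat x y p q : simple_path (edges T) x y (p ++ q) ->
  between (tree_dist T) x (last x p) y.
Proof.
move=> spq; have [sp sq] := simple_path_split spq.
rewrite /between (tree_distE spq) (tree_distE sp) (tree_distE sq).
by rewrite /path_edges pairmap_cat big_cat.
Qed.

Lemma tree_path_between x y z :
  z \in x :: tree_path T x y -> between (tree_dist T) x z y.
Proof.
have := tree_pathP x y; move: (tree_path T x y) => p sp zp.
by case/splitPl: zp sp => p1 p2 <-; apply: tree_dist_cat.
Qed.

(** The paths from [x] to [t] and from [t] to [y] form a walk, which shortens to the only simple
    path from [x] to [y] without adding vertices. *)
Lemma tree_path_cut x y z t : z \in x :: tree_path T x y ->
  z \in x :: tree_path T x t \/ z \in t :: tree_path T t y.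
Proof.
move=> zp; apply/orP; apply: contraLR zp; rewrite negb_or => /andP[zxt zty].
have [/and3P[p1 _ /eqP l1] /and3P[p2 _ /eqP l2]] :=
  (tree_pathP x t, tree_pathP t y).
have pw : path (adj (edges T)) x (tree_path T x t ++ tree_path T t y).
  by rewrite cat_path p1 l1.
have lw : last x (tree_path T x t ++ tree_path T t y) = y.
  by rewrite last_cat l1.
case: (shortenP pw) lw => r pr ur sr lr.
have -> : tree_path T x y = r.
  by apply: tree_pathE; rewrite /simple_path pr ur lr eqxx.
move: zxt zty; rewrite !inE !negb_or => /andP[-> zxt] /andP[_ zty] /=.
by apply/negP=> /sr; rewrite mem_cat (negPf zxt) (negPf zty).
Qed.

(* The median is the first vertex of the path from [x] to [y] that lies on the
   path from [y] to [z]. *)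
Lemma tree_median x y z : exists2 m, m \in y :: tree_path T y z &
  between (tree_dist T) x m y /\ between (tree_dist T) x m z.
Proof.
have := tree_pathP x y; move: (tree_path T x y) => p sp.
have hit : has (mem (y :: tree_path T y z)) (x :: p).
  apply/hasP; exists y; last exact: mem_head.
  by case/and3P: sp => _ _ /eqP <-; apply: mem_last.
have [p1 [p2 [ep Sm first_m]]] := first_hit hit.
rewrite {}ep in sp; exists (last x p1); first exact: Sm.
split; first exact: tree_dist_cat sp.
have [sp1 _] := simple_path_split sp.
have := tree_pathP y z.
have {}Sm : last x p1 \in y :: tree_path T y z := Sm.
case/splitPl: Sm first_m => q1 q2 lq first_m sq.
have [_ sq2] := simple_path_split sq; rewrite lq in sq2.
apply: (tree_dist_cat (q := q2)).
(* The path from [x] to the median meets the path from [y] to [z] only there, so continuing along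
   the latter to [z] stays simple. *)
apply: (simple_path_cat sp1 sq2) => v vq; apply/negP => /first_m vm.
case/and3P: sq2 => _ /andP[+ _] _; rewrite -vm ?vq //=.
by rewrite inE mem_cat vq !orbT.
Qed.

End Tree.

(** The two weight functions have different domain types, hence the comparison through
    [edge_weight]; the proofs of [is_tree] agree by proof irrelevance. *)
Lemma weighted_tree_eq (R : realType) (V : finType) (T1 T2 : weighted_tree R V) :
  edges T1 = edges T2 -> edge_weight T1 =1 edge_weight T2 -> T1 = T2.
Proof.
case: T1 T2 => [E1 t1 w1] [E2 t2 w2] /= eE; subst E2 => ew.
rewrite (Prop_irrelevance t1 t2); congr WeightedTree; apply/ffunP=> e.
by have := ew (val e); rewrite !edge_weightE.
Qed.

(** * Metrics realized by a weighted tree *)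

Section Realized.
Variables (R : realType) (V : finType) (D : V -> V -> R).
Hypothesis D_sym : forall x y, D x y = D y x.
Hypothesis D_diag : forall x, D x x = 0.
Hypothesis D_pos : forall x y, x != y -> 0 < D x y.
Variable T : weighted_tree R V.
Hypothesis TD : realizes T D.

Let distE x y : tree_dist T x y = D x y.
Proof. by case: TD. Qed.

Let betweenE x y z : between (tree_dist T) x y z = between D x y z.
Proof. by rewrite /between !distE. Qed.

Lemma realizes_medians : has_medians D.
Proof.
move=> x y z; have [m /tree_path_between + []] := tree_median T x y z.
by rewrite !betweenE; exists m.
Qed.

(** For the direction from distances to paths, take the median [m] of [z], [x], [y] on the path:
    additivity at both [z] and [m] forces [D z m = 0], so [z = m]. *)
Lemma realizes_betweenP x y z :
  reflect (between D x z y) (z \in x :: tree_path T x y).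
Proof.
apply: (iffP idP) => [/tree_path_between|/eqP xzy]; first by rewrite betweenE.
have [m mp []] := tree_median T z x y.
rewrite !betweenE => /eqP zx /eqP zy; have := tree_path_between mp.
rewrite betweenE => /eqP xy.
have [->//|/D_pos] := eqVneq z m.
by have := (D_sym x z, D_sym m x); case; lra.
Qed.

Lemma realizes_cut x y p t :
  between D x p y -> between D x p t \/ between D t p y.
Proof.
move=> /realizes_betweenP/(tree_path_cut t).
by case=> /realizes_betweenP; [left|right].
Qed.

Lemma realizes_four_point : four_point D.
Proof.
apply: (cut_medians_four_point D_sym D_diag D_pos realizes_medians).
exact: realizes_cut.
Qed.

(** The points between [x] and [y] are the vertices of their path, so a gap is a path with no inner
    vertex. *)
Lemma realizes_adj x y : x != y -> adj (edges T) x y = gap D x y.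
Proof.
move=> nxy; apply/idP/idP => [xy|].
  have tp : tree_path T x y = [:: y].
    by apply: tree_pathE; rewrite /simple_path /= xy inE nxy eqxx.
  rewrite /gap nxy; apply/forallP=> z; apply/implyP => /realizes_betweenP.
  by rewrite tp !inE.
move=> g; have := tree_pathP T x y; have := @realizes_betweenP x y.
case: (tree_path T x y) => [|a [|b p]] bt.
- by case/and3P=> _ _ /= exy; rewrite exy in nxy.
- by case/and3P=> /= + _ /eqP <-; rewrite andbT.
case/and3P=> _ unq /eqP ly.
have /bt/(gapP g)[ea|ea] : a \in [:: x, a, b & p] by rewrite !inE eqxx orbT.
  by move: unq; rewrite ea /= inE eqxx.
by move: unq ly; rewrite /= => /and3P[_ + _] ly; rewrite ea -ly mem_last.
Qed.

Lemma realizes_edges : edges T = gap_edges D.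
Proof.
have [_ card2 _ _] := edgesP T.
apply/setP=> e; apply/idP/idP => [eT|].
  have /eqP/cards2P[x [y [nxy ee]]] := card2 e eT.
  rewrite ee in eT *; rewrite inE; apply/existsP; exists x; apply/existsP.
  by exists y; rewrite eqxx -realizes_adj.
rewrite inE => /existsP[x /existsP[y /andP[/eqP -> g]]].
by move: (g); rewrite -realizes_adj //; case/andP: g.
Qed.

Lemma realizes_weight e : e \in edges T -> edge_weight T e = edge_length D e.
Proof.
have [_ card2 _ _] := edgesP T.
move=> eT; have /eqP/cards2P[x [y [nxy ee]]] := card2 e eT.
rewrite ee edge_length2 // -distE (@tree_distE _ _ _ _ _ [:: y]).
  by rewrite /= big_seq1.
by rewrite /simple_path /= inE nxy /adj -ee eT eqxx.
Qed.

End Realized.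

(** * Uniqueness and existence of the realizing tree *)

Lemma realizes_unique (R : realType) (V : finType) (D : V -> V -> R) :
  (forall x y, D x y = D y x) -> (forall x, D x x = 0) ->
  (forall x y, x != y -> 0 < D x y) ->
  forall T1 T2 : weighted_tree R V, realizes T1 D -> realizes T2 D -> T1 = T2.
Proof.
move=> D_sym D_diag D_pos T1 T2 T1D T2D.
have E1 := realizes_edges D_sym D_pos T1D.
have E2 := realizes_edges D_sym D_pos T2D.
apply: weighted_tree_eq; first by rewrite E1.
move=> e; have [eE|eE] := boolP (e \in gap_edges D).
  rewrite (realizes_weight D_sym D_diag T1D) ?E1 //.
  by rewrite (realizes_weight D_sym D_diag T2D) ?E2.
by rewrite /edge_weight !insubN ?E1 ?E2.
Qed.

Lemma median_metric_realized (R : realType) (V : finType) (D : V -> V -> R) :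
  (0 < #|V|)%N ->
  (forall x y, D x y = D y x) -> (forall x, D x x = 0) ->
  (forall x y, x != y -> 0 < D x y) ->
  four_point D -> has_medians D -> exists T : weighted_tree R V, realizes T D.
Proof.
move=> V_gt0 D_sym D_diag D_pos fourD medD.
pose T := WeightedTree (gap_tree D_sym D_diag D_pos fourD medD V_gt0)
  [ffun e => edge_length D (val e)].
exists T; split.
  move=> e; rewrite ffunE; have := valP e; rewrite inE.
  case/existsP=> x /existsP[y /andP[/eqP -> /andP[nxy _]]].
  by rewrite edge_length2 // D_pos.
move=> x y; have sp := tree_pathP T x y; rewrite (tree_distE sp).
case/and3P: sp => pp up /eqP {2}<-.
rewrite -(gap_path_length D_sym D_diag D_pos fourD medD pp up).
apply: eq_big_seq => e /(path_edges_sub pp) eT.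
pose e' : {e | e \in edges T} := exist _ e eT.
by rewrite -[e in LHS]/(val e') edge_weightE ffunE.
Qed.

Theorem theorem2p1 (R : realType) (n : nat) (n_ge3 : (3 <= n)%N)
    (D : 'I_n -> 'I_n -> R)
    (D_sym : forall i j : 'I_n, D i j = D j i)
    (D_diag : forall i : 'I_n, D i i = 0)
    (D_pos : forall i j : 'I_n, i != j -> 0 < D i j) :
  ((exists T : weighted_tree R 'I_n, realizes T D) <->
   [/\ (* four-point condition *)
       forall i j k h : 'I_n,
         max_attained_twice (D i j + D k h) (D i k + D j h) (D i h + D k j),
       (* (i) *)
       forall i j k t : 'I_n,
         D i j + D k t = D i k + D j t ->
         D i k + D j t = D i t + D j k ->
         exists l : 'I_n,
           forall u v : 'I_n,
             u \in [set i; j; k; t] -> v \in [set i; j; k; t] -> u != v ->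
             D u v = D u l + D v l
     & (* (ii) *)
       forall i j k t : 'I_n,
         D i j + D k t < D i k + D j t ->
         D i k + D j t = D i t + D j k ->
         forall u v w : 'I_n,
           u \in [set i; j; k; t] -> v \in [set i; j; k; t] ->
           w \in [set i; j; k; t] ->
           exists l : 'I_n,
             [/\ D u v = D u l + D v l,
                 D u w = D u l + D w l,
                 D v w = D v l + D w l,
                 D u v + D w l = D u w + D v l
               & D u w + D v l = D u l + D v w]])
  /\
  (forall T1 T2 : weighted_tree R 'I_n,
     realizes T1 D -> realizes T2 D -> T1 = T2).
Proof.
split; last exact: realizes_unique.
split=> [[T TD]|[fourD _ medii]].
  have med := realizes_medians TD.
  have fourD := realizes_four_point D_sym D_diag D_pos TD.
  split=> [//|i j k t e1 e2|i j k t _ _ u v w _ _ _].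
    have [l [bij bik bjk]] := med i j k; exists l.
    have cut := realizes_cut D_sym D_pos TD t bij.
    move: bij bik bjk cut; rewrite /between (D_sym l t) (D_sym l j) (D_sym l k).
    rewrite (D_sym t j) => /eqP ij /eqP ik /eqP jk cut.
    (* By [e1] and [e2] the differences [D i t - D i l], [D j t - D j l] and [D k t - D k l]
       coincide; the cut property makes one of the first two equal to [D t l]. *)
    have it : D i t = D i l + D t l by case: cut => /eqP; lra.
    have jt : D j t = D j l + D t l by lra.
    have kt : D k t = D k l + D t l by lra.
    move=> u v; rewrite !inE -!orbA.
    case/or4P=> /eqP-> /or4P[]/eqP->; rewrite ?eqxx // => _;
    by rewrite ?(D_sym j i, D_sym k i, D_sym k j, D_sym t i,
      D_sym t j, D_sym t k); lra.
  (* For a median [l], the three sums in the last two equations all equal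
     [D u l + D v l + D w l]. *)
  have [l [/eqP uv /eqP uw /eqP vw]] := med u v w; exists l.
  by have := (D_sym l v, D_sym l w); case=> *; split; lra.
apply: median_metric_realized => //; first by rewrite card_ord (leq_trans _ n_ge3).
move=> x y z; have tri := four_point_triangle D_sym D_diag fourD.
(* If [z] is between [x] and [y], it is their median with [z]; otherwise the triangle inequality is
   strict, as (ii) requires for [x], [y], [z], [z]. *)
have [e|nlt] := eqVneq (D x y) (D x z + D z y).
  by exists z; rewrite /between !D_diag !addr0 e !eqxx.
have lt : D x y + D z z < D x z + D y z.
  by rewrite D_diag addr0 (D_sym y) lt_neqAle nlt tri.
have [||| l [xy xz yz _ _]] := medii x y z z lt erefl x y z;
  rewrite ?inE ?eqxx ?orbT //.
by exists l; rewrite /between xy xz yz (D_sym l y) (D_sym l z) !eqxx.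
Qed.
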